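(* Let $\mathcal{H}$ be a real Hilbert space, let $V\subseteq\mathcal{H}$ be a closed vector subspace, and let $T:\mathcal{H}\rightrightarrows\mathcal{H}$ be a maximal monotone operator for which there exist $\eta>0$ and $L>0$ such that $$\langle z-z',v-v'\rangle\ge \eta\|z-z'\|^2\quad\text{and}\quad \|v-v'\|\le L\|z-z'\|\qquad \forall\, v\in T(z),\ v'\in T(z').$$ Then the partial inverse $T_V$ of $T$ with respect to $V$ is $\mu$-strongly (maximal) monotone with $$\mu=\frac{\eta}{1+L^2}>0;$$ that is, $T_V$ is maximal monotone and $\langle z-z',v-v'\rangle\ge\mu\|z-z'\|^2$ for all $v\in T_V(z)$, $v'\in T_V(z')$.
   Context: A set-valued map $T:\mathcal{H}\rightrightarrows\mathcal{H}$ is monotone if $\langle z-z',v-v'\rangle\ge0$ for all $v\in T(z)$, $v'\in T(z')$; it is maximal monotone if moreover its graph $G(T)=\{(z,v)\in\mathcal{H}\times\mathcal{H} : v\in T(z)\}$ is not properly contained in the graph of any other monotone operator on $\mathcal{H}$. $P_V$ and $P_{V^\perp}$ denote the orthogonal projections onto $V$ and $V^\perp$. The (Spingarn) partial inverse of a maximal monotone operator $T$ with respect to the closed subspace $V$ is the operator $T_V:\mathcal{H}\rightrightarrows\mathcal{H}$ whose graph is $$G(T_V)=\{(z,v)\in\mathcal{H}\times\mathcal{H} : P_V(v)+P_{V^\perp}(z)\in T(P_V(z)+P_{V^\perp}(v))\}.$$ It is a known fact that $T_V$ is maximal monotone whenever $T$ is. *)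

(* Defs.v *)
From HB Require Import structures.
From mathcomp Require Export all_boot all_order all_algebra.
From mathcomp Require Export sesquilinear.
From mathcomp Require Export all_classical all_reals.
From mathcomp Require Export topology normedtype.

Set Implicit Arguments.
Unset Strict Implicit.
Unset Printing Implicit Defensive.

Import Order.TTheory GRing.Theory Num.Theory.
Import numFieldNormedType.Exports.

Local Open Scope classical_set_scope.
Local Open Scope ring_scope.

(* A real Hilbert space is a complete normed module over a realType, together
   with a positive definite symmetric bilinear form that induces its norm. *)
Definition induces_norm (R : realType) (H : completeNormedModType R)
    (ip : {dot H for idfun}) : Prop :=
  forall x : H, ip x x = `|x| ^+ 2.

Section Definitions.
Context (R : realType) (H : completeNormedModType R) (ip : {dot H for idfun}).

Definition closed_subspace (V : set H) : Prop :=
  closed V /\ submod_closed (mem V).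

Definition orthocomp (V : set H) : set H :=
  [set x | forall w, V w -> ip x w = 0].

(* [xget] selects a point of the set when it is nonempty and returns the default
   [0] otherwise; for a closed subspace [V] the set below is a singleton. *)
Definition orthoproj (V : set H) (x : H) : H :=
  xget 0 [set p | V p /\ orthocomp V (x - p)].

(* A set-valued map is a function [T : H -> set H], with [T z v] for v in T(z). *)
Definition graph (T : H -> set H) : set (H * H) := [set zv | T zv.1 zv.2].

Definition monotone_op (T : H -> set H) : Prop :=
  forall z z' v v', T z v -> T z' v' -> 0 <= ip (z - z') (v - v').

Definition maximal_monotone (T : H -> set H) : Prop :=
  monotone_op T /\
  forall S : H -> set H, monotone_op S -> ~ (graph T `<` graph S).

Definition strongly_monotone (mu : R) (T : H -> set H) : Prop :=
  forall z z' v v', T z v -> T z' v' ->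
    mu * `|z - z'| ^+ 2 <= ip (z - z') (v - v').

Definition lipschitz_op (L : R) (T : H -> set H) : Prop :=
  forall z z' v v', T z v -> T z' v' -> `|v - v'| <= L * `|z - z'|.

Definition partial_inverse (V : set H) (T : H -> set H) : H -> set H :=
  fun z => [set v |
    T (orthoproj V z + orthoproj (orthocomp V) v)
      (orthoproj V v + orthoproj (orthocomp V) z)].

End Definitions.

(* Main.v *)
Require Import Defs.
From mathcomp Require Import all_boot all_order all_algebra sesquilinear.
From mathcomp Require Import all_classical all_reals topology normedtype.
From mathcomp Require Import ring lra.
Set Implicit Arguments.
Unset Strict Implicit.
Unset Printing Implicit Defensive.

Import Order.TTheory GRing.Theory Num.Theory.
Import numFieldNormedType.Exports.
Local Open Scope classical_set_scope.
Local Open Scope ring_scope.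

(* The coordinate exchange (z, v) |-> (P z + Q v, P v + Q z), with P and Q the
   projections onto V and its orthogonal complement, is an involution of H * H
   which preserves <z - z', v - v'> and carries the graph of T_V onto the graph
   of T; hence (maximal) monotonicity passes from T to T_V. Writing (a, b) for
   the image of a difference (dz, dv), Pythagoras and the Lipschitz bound give
   |dz|^2 <= |a|^2 + |b|^2 <= (1 + L^2) |a|^2, while strong monotonicity of T
   gives <dz, dv> = <a, b> >= eta |a|^2. *)

Section Hilbert.
Context (R : realType) (H : completeNormedModType R) (ip : {dot H for idfun}).
Hypothesis ip_norm : induces_norm ip.
Implicit Types (x y z v w p : H) (V : set H) (T S : H -> set H).

(** * Inner product and norm identities *)

Lemma ipC x y : ip x y = ip y x.
Proof. by rewrite hermC expr0 mul1r. Qed.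

Lemma ipDl x y z : ip (x + y) z = ip x z + ip y z.
Proof. exact: linearDl. Qed.

Lemma ipDr x y z : ip x (y + z) = ip x y + ip x z.
Proof. exact: linearDr. Qed.

Lemma ipZl (a : R) x y : ip (a *: x) y = a * ip x y.
Proof. by rewrite linearZl_LR. Qed.

Lemma norm_ipD x y : `|x + y| ^+ 2 = `|x| ^+ 2 + ip x y *+ 2 + `|y| ^+ 2.
Proof.
by rewrite -!ip_norm ipDl !ipDr (ipC y x) mulr2n !addrA.
Qed.

Lemma norm_ipB x y : `|x - y| ^+ 2 = `|x| ^+ 2 - ip x y *+ 2 + `|y| ^+ 2.
Proof. by rewrite norm_ipD linearNr /= normrN mulNrn. Qed.

Lemma parallelogram x y :
  `|x + y| ^+ 2 + `|x - y| ^+ 2 = `|x| ^+ 2 *+ 2 + `|y| ^+ 2 *+ 2.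
Proof. by rewrite norm_ipD norm_ipB; ring. Qed.

(** * Orthogonal projection onto a closed subspace *)

Section Subspace.
Variable V : set H.
Hypothesis V_closed : closed_subspace V.

Lemma subspace0 : V 0.
Proof. by case: V_closed => _ [+ _]; rewrite -topredE /= in_setE. Qed.

Lemma subspaceP (a : R) x y : V x -> V y -> V (a *: x + y).
Proof.
case: V_closed => _ [_ VP] Vx Vy.
have := VP a x y; rewrite -!topredE /= !in_setE; exact.
Qed.

Lemma subspaceD x y : V x -> V y -> V (x + y).
Proof. by move=> Vx Vy; rewrite -[x]scale1r; apply: subspaceP. Qed.

Lemma subspaceZ (a : R) x : V x -> V (a *: x).
Proof.
by move=> Vx; rewrite -[_ *: _]addr0; apply: subspaceP => //; apply: subspace0.
Qed.

Lemma subspaceB x y : V x -> V y -> V (x - y).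
Proof. by move=> Vx Vy; rewrite -[- y]scaleN1r addrC; apply: subspaceP. Qed.

Lemma best_approximation x :
  exists2 p, V p & forall w, V w -> `|x - p| <= `|x - w|.
Proof.
(* By the parallelogram identity, the sets A e of e-almost minimizers generate a
   Cauchy filter as e tends to 0; its limit is the best approximation. *)
pose D := [set `|x - w| | w in V].
have D_lb : has_lbound D by exists 0 => _ [w _ <-].
have Dinf : has_inf D by split => //; exists `|x - 0|, 0 => //; apply: subspace0.
pose d := inf D.
have d_le w : V w -> d <= `|x - w| by move=> Vw; apply: ge_inf => //; exists w.
have d_ge0 : 0 <= d.
  by apply: lb_le_inf => [|_ [w _ <-]//]; case: Dinf.
pose A e := [set w | V w /\ `|x - w| < d + e].
have A_ex e : 0 < e -> exists w, A e w.
  by move=> /inf_adherent /(_ Dinf) [_ [w Vw <-] le_w]; exists w.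
pose F := filter_from [set e : R | 0 < e] A.
have F_proper : ProperFilter F.
  apply: filter_from_proper => [|e /A_ex//].
  apply: filter_from_filter => [|e1 e2 /= e1_gt0 e2_gt0].
    by exists 1 => /=.
  exists (Num.min e1 e2) => /=; first by rewrite lt_min e1_gt0.
  move=> w [Vw le_w]; split; split => //; apply: (lt_le_trans le_w);
    by rewrite lerD2l ge_min lexx ?orbT.
(* The midpoint of [v] and [w] lies in [V], hence at distance at least [d] from [x]; the
   parallelogram identity then gives the bound 4 (d + e)^2 - 4 d^2. *)
have A_close e v w : A e v -> A e w ->
    `|v - w| ^+ 2 <= 8%:R * (d * e) + 4%:R * e ^+ 2.
  move=> [Vv lt_v] [Vw lt_w].
  have := parallelogram (x - v) (x - w).
  have -> : x - v - (x - w) = w - v by rewrite opprB addrC addrA subrK.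
  have -> : x - v + (x - w) = 2%:R *: (x - 2%:R^-1 *: (v + w)).
    rewrite scalerBr scalerA divff ?pnatr_eq0// scale1r scaler_nat mulr2n.
    by rewrite opprD addrACA.
  rewrite normrZ ger0_norm // (distrC w).
  have := d_le _ (subspaceZ 2%:R^-1 (subspaceD Vv Vw)).
  have := normr_ge0 (x - v); have := normr_ge0 (x - w).
  move: lt_v lt_w d_ge0; nra.
have F_cauchy : cauchy F.
  apply: cauchy_exP => e /= e_gt0.
  (* As e' <= 1, 8 d e' + 4 e'^2 <= (8 d + 4) e' = e^2 - e' e^2; the summand e^2 in the denominator
     makes the final bound strict. *)
  pose e' := e ^+ 2 / (8%:R * d + 4%:R + e ^+ 2).
  have den_gt0 : 0 < 8%:R * d + 4%:R + e ^+ 2 by nra.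
  have e'E : e' * (8%:R * d + 4%:R + e ^+ 2) = e ^+ 2.
    by rewrite /e' divfK // gt_eqF.
  have e'_gt0 : 0 < e' by rewrite divr_gt0 ?exprn_gt0.
  have e'_lt1 : e' <= 1.
    by rewrite ler_pdivrMr // mul1r; nra.
  have [y Ay] := A_ex _ e'_gt0.
  exists y, e' => // w Aw; rewrite -ball_normE /=.
  rewrite -(ltr_pXn2r (n := 2)) ?nnegrE ?(ltW e_gt0) //.
  apply: le_lt_trans (A_close _ _ _ Ay Aw) _.
  have : 0 < e ^+ 2 by rewrite exprn_gt0.
  nra.
have /cauchy_cvgP/cvg_ex[p Fp] := F_cauchy.
exists p => [|w Vw].
  apply: (closed_cvg (F := F) (u_ := id) V) Fp; first by case: V_closed.
  by exists 1 => //= w [].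
apply: le_trans (d_le _ Vw); apply/ler_addgt0Pr => e e_gt0.
have e2_gt0 : 0 < e / 2%:R by rewrite divr_gt0.
have Fball : F (ball p (e / 2%:R)) by apply: Fp; apply: nbhsx_ballx.
have FA : F (A (e / 2%:R)) by exists (e / 2%:R).
have [v [pv [_ vx]]] := filter_ex (filterI Fball FA).
rewrite -ball_normE /= distrC in pv.
have := ler_normD (x - v) (v - p); rewrite subrKA; lra.
Qed.

Lemma best_approximation_orthocomp x p :
  V p -> (forall w, V w -> `|x - p| <= `|x - w|) -> orthocomp ip V (x - p).
Proof.
move=> Vp p_min w Vw.
set c := ip _ _; set n := `|w| ^+ 2.
have n_ge0 : 0 <= n by rewrite exprn_ge0.
have n1_gt0 : 0 < n + 1 by rewrite ltr_wpDl.
pose t := c / (n + 1).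
have tE : t * (n + 1) = c by rewrite /t divfK // gt_eqF.
(* The optimal step c / n is replaced by c / (n + 1) to avoid the case n = 0. *)
have : `|x - p| ^+ 2 <= `|x - p - t *: w| ^+ 2.
  rewrite lerXn2r ?nnegrE // -addrA -opprD.
  by apply: p_min; rewrite addrC; apply: subspaceP.
rewrite (norm_ipB (x - p)) ipC ipZl ipC -/c normrZ exprMn real_normK ?num_real // -/n -tE.
(* Here [le] amounts to 2 t^2 (n + 1) <= t^2 n, that is, (n + 2) t^2 <= 0. *)
move=> le; have t2 : t ^+ 2 <= 0 by nra.
have /eqP -> : t == 0 by rewrite -sqrf_eq0 eq_le t2 sqr_ge0.
by rewrite mul0r.
Qed.

(** The best approximation inhabits the set from which [xget] chooses, so the chosen point has the
    defining properties. *)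
Lemma orthoprojP x :
  V (orthoproj ip V x) /\ orthocomp ip V (x - orthoproj ip V x).
Proof.
have [p Vp p_min] := best_approximation x.
have := @xgetPex _ 0 [set p | V p /\ orthocomp ip V (x - p)].
by apply; exists p; split => //; apply: best_approximation_orthocomp.
Qed.

Lemma orthocompB x y :
  orthocomp ip V x -> orthocomp ip V y -> orthocomp ip V (x - y).
Proof. by move=> Vx Vy w Vw; rewrite linearBl /= Vx ?Vy ?subrr. Qed.

(** The difference of two candidates lies both in [V] and in its complement, so it is orthogonal to
    itself. *)
Lemma orthoproj_unique x p :
  V p -> orthocomp ip V (x - p) -> orthoproj ip V x = p.
Proof.
move=> Vp Vxp; have [Vq Vxq] := orthoprojP x.
have /= := orthocompB Vxp Vxq (subspaceB Vq Vp).
rewrite opprB addrC addrA subrK ip_norm => /eqP.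
by rewrite sqrf_eq0 normr_eq0 subr_eq0 => /eqP.
Qed.

Lemma orthoprojB x y :
  orthoproj ip V (x - y) = orthoproj ip V x - orthoproj ip V y.
Proof.
have [Vx Wx] := orthoprojP x; have [Vy Wy] := orthoprojP y.
apply: orthoproj_unique; first exact: subspaceB.
by rewrite opprD addrACA -opprD; apply: orthocompB.
Qed.

Lemma orthoproj_orthocomp x :
  orthoproj ip (orthocomp ip V) x = x - orthoproj ip V x.
Proof.
have [Vx Wx] := orthoprojP x.
apply: xget_unique => [|q [Wq WWq]].
  by split=> // w Ww; rewrite subKr ipC; apply: Ww.
pose r := q - (x - orthoproj ip V x).
have Wr : orthocomp ip V r by apply: orthocompB.
have : ip r r = 0.
  (* With P the projection onto [V], r = P x - (x - q), and both terms are orthogonal to [r], which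
     lies in the complement. *)
  rewrite {1}/r opprB addrA [q + _]addrC -addrA -opprB linearBl /=.
  by rewrite (WWq _ Wr) ipC (Wr _ Vx) subr0.
by rewrite ip_norm => /eqP; rewrite sqrf_eq0 normr_eq0 subr_eq0 => /eqP.
Qed.

(** * The coordinate exchange *)

(** One function serves both coordinates: (z, v) goes to ([exchange z v], [exchange v z]). *)
Definition exchange z v : H := orthoproj ip V z + (v - orthoproj ip V v).

Lemma partial_inverseE T z v :
  partial_inverse ip V T z v = T (exchange z v) (exchange v z).
Proof. by rewrite /partial_inverse /= !orthoproj_orthocomp. Qed.

Lemma orthoproj_exchange z v :
  orthoproj ip V (exchange z v) = orthoproj ip V z.
Proof.
have [Vz _] := orthoprojP z; have [_ Wv] := orthoprojP v.
by apply: orthoproj_unique => //; rewrite /exchange addrC addKr.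
Qed.

Lemma exchangeK z v : exchange (exchange z v) (exchange v z) = z.
Proof.
rewrite {1}/exchange !orthoproj_exchange {1}/exchange.
by rewrite [orthoproj _ _ v + _]addrC addrK addrC subrK.
Qed.

Lemma exchangeB z z' v v' :
  exchange z v - exchange z' v' = exchange (z - z') (v - v').
Proof.
by rewrite /exchange orthoprojB orthoprojB !opprD addrACA (addrACA v).
Qed.

(** Split z = p + q and v = s + r along [V] and its complement: cross terms vanish and both sides
    become <p, s> + <q, r>. *)
Lemma ip_exchange z v : ip (exchange z v) (exchange v z) = ip z v.
Proof.
have [Vz Wz] := orthoprojP z; have [Vv Wv] := orthoprojP v.
rewrite -[in RHS](subrKC (orthoproj ip V z) z).
rewrite -[in RHS](subrKC (orthoproj ip V v) v).
rewrite /exchange; move: Vz Wz Vv Wv.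
move: (orthoproj _ _ z) (orthoproj _ _ v) (z - _) (v - _) => p s q r Vp Wq Vs Wr.
rewrite !ipDl !ipDr (Wr _ Vs) (Wq _ Vs).
by rewrite !(ipC p) (Wq _ Vp) (Wr _ Vp) (ipC r) !addr0 !add0r.
Qed.

(** In the same splitting, the right side is |z|^2 + |v|^2 by Pythagoras. *)
Lemma norm_le_exchange z v :
  `|z| ^+ 2 <= `|exchange z v| ^+ 2 + `|exchange v z| ^+ 2.
Proof.
have [Vz Wz] := orthoprojP z; have [Vv Wv] := orthoprojP v.
rewrite -{1}(subrKC (orthoproj ip V z) z) /exchange; move: Vz Wz Vv Wv.
move: (orthoproj _ _ z) (orthoproj _ _ v) (z - _) (v - _) => p s q r Vp Wq Vs Wr.
rewrite !norm_ipD !(ipC p) (ipC s) (Wq _ Vp) (Wr _ Vp) (Wq _ Vs).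
have := sqr_ge0 `|s|; have := sqr_ge0 `|r|; lra.
Qed.

(** * Transfer of monotonicity properties to the partial inverse *)

Lemma partial_inverseK T : partial_inverse ip V (partial_inverse ip V T) = T.
Proof.
apply/funext => z; apply/funext => v.
by rewrite !partial_inverseE !exchangeK.
Qed.

Lemma monotone_partial_inverse T :
  monotone_op ip T -> monotone_op ip (partial_inverse ip V T).
Proof.
move=> mT z z' v v'; rewrite !partial_inverseE => Tzv Tzv'.
by have := mT _ _ _ _ Tzv Tzv'; rewrite !exchangeB ip_exchange.
Qed.

Lemma graph_partial_inverse_subset T S :
  graph T `<=` graph S ->
  graph (partial_inverse ip V T) `<=` graph (partial_inverse ip V S).
Proof.
move=> TS [z v]; rewrite /graph /= !partial_inverseE.
exact: (TS (_, _)).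
Qed.

(** Taking partial inverses is an involution that preserves monotonicity and graph inclusion, so a
    proper monotone extension of the partial inverse would yield one of [T]. *)
Lemma maximal_monotone_partial_inverse T :
  maximal_monotone ip T -> maximal_monotone ip (partial_inverse ip V T).
Proof.
move=> [mT maxT]; split=> [|S mS]; first exact: monotone_partial_inverse.
move=> [sub nsub].
apply: (maxT _ (monotone_partial_inverse mS)).
split.
  by rewrite -{1}(partial_inverseK T); apply: graph_partial_inverse_subset.
by move=> /graph_partial_inverse_subset; rewrite partial_inverseK.
Qed.

Lemma strongly_monotone_partial_inverse T (eta L : R) :
  0 <= eta -> strongly_monotone ip eta T -> lipschitz_op L T ->
  strongly_monotone ip (eta / (1 + L ^+ 2)) (partial_inverse ip V T).
Proof.
move=> eta_ge0 sT lT z z' v v'; rewrite !partial_inverseE => Tzv Tzv'.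
have := sT _ _ _ _ Tzv Tzv'; have := lT _ _ _ _ Tzv Tzv'.
rewrite !exchangeB ip_exchange => lip strong.
apply: le_trans strong.
have L1_gt0 : 0 < 1 + L ^+ 2 by rewrite ltr_pwDl ?sqr_ge0.
rewrite mulrAC ler_pdivrMr // -mulrA ler_wpM2l //.
apply: le_trans (norm_le_exchange _ (v - v')) _.
rewrite mulrDr mulr1 lerD2l mulrC -exprMn lerXn2r ?nnegrE //.
(* Comparing squares leaves the nonnegativity of the upper bound in [lip], which holds because it
   dominates a norm. *)
exact: le_trans lip.
Qed.

End Subspace.
End Hilbert.

Theorem proposition2p2 (R : realType) (H : completeNormedModType R)
    (ip : {dot H for idfun}) (ip_norm : induces_norm ip)
    (V : set H) (V_closed : closed_subspace V)
    (T : H -> set H) (T_max : maximal_monotone ip T)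
    (eta L : R) (eta_gt0 : 0 < eta) (L_gt0 : 0 < L)
    (T_strong : strongly_monotone ip eta T) (T_lip : lipschitz_op L T) :
  [/\ 0 < eta / (1 + L ^+ 2),
      maximal_monotone ip (partial_inverse ip V T)
    & strongly_monotone ip (eta / (1 + L ^+ 2)) (partial_inverse ip V T)].
Proof.
split.
- by rewrite divr_gt0 // ltr_pwDl ?sqr_ge0.
- exact: maximal_monotone_partial_inverse.
- by apply: strongly_monotone_partial_inverse => //; apply: ltW.
Qed.
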